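(* Let $n$ be an odd positive integer. For nonnegative integers $k$, define $$F_n(k) := \sum_{j=1}^n \left((-1)^{n-j+1}\,2\cos\left(\frac{j\pi}{2n+1}\right)\right)^k,$$ and let $$u_n := \prod_{j=1}^n \left(\tan\left(\frac{(2j-1)\pi}{8n+4}\right)\right)^{(2j-1)(-1)^j}.$$ Then $u_n$ is a unit algebraic integer, and Catalan's constant $G$ has the series acceleration formula $$G = \left(\frac{\pi}{4n+4}\right)\log u_n - \left(\frac{2n+1}{4n+4}\right)\sum_{k=0}^\infty \frac{F_n(2k+1)}{(2k+1)^2\binom{2k}{k}}.$$
   Context: Catalan's constant is $G := \sum_{k=0}^\infty \frac{(-1)^k}{(2k+1)^2}$. A unit algebraic integer (algebraic unit) is an invertible algebraic integer, i.e. a nonzero algebraic integer whose multiplicative inverse is also an algebraic integer. *)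

(* Defs.v *)
From mathcomp Require Import all_boot all_order all_algebra.
From mathcomp Require Import all_classical all_reals all_analysis.

Set Implicit Arguments.
Unset Strict Implicit.
Unset Printing Implicit Defensive.

Import Order.TTheory GRing.Theory Num.Theory numFieldNormedType.Exports.

Local Open Scope ring_scope.

Definition algebraic_integer (K : fieldType) (x : K) : Prop :=
  integralOver (intr : int -> K) x.

Definition algebraic_unit (K : fieldType) (x : K) : Prop :=
  [/\ x != 0, algebraic_integer x & algebraic_integer x^-1].

Section Catalan.
Variable R : realType.

Definition catalan_term (k : nat) : R := (-1) ^+ k / (2 * k%:R + 1) ^+ 2.

Definition catalan : R := limn (series catalan_term).

Definition accel_F (n k : nat) : R :=
  \sum_(1 <= j < n.+1)
    ((-1) ^+ (n - j + 1)%N * 2 * cos (j%:R * pi / (2 * n%:R + 1))) ^+ k.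

(* The exponent (2j-1)(-1)^j is a possibly negative integer, so the power is
   the integer power [exprz]. *)
Definition accel_u (n : nat) : R :=
  \prod_(1 <= j < n.+1)
    tan ((2 * j%:R - 1) * pi / (8 * n%:R + 4))
      ^ ((2 * j%:Z - 1) * (-1) ^+ j).

Definition accel_term (n k : nat) : R :=
  accel_F n (2 * k + 1)%N / ((2 * k%:R + 1) ^+ 2 * 'C(2 * k, k)%:R).

End Catalan.

(* Main.v *)
Require Import Defs.
From mathcomp Require Import all_boot all_order all_algebra.
From mathcomp Require Import all_classical all_reals all_analysis.
From mathcomp Require Import ring lra zify.
Import Order.TTheory GRing.Theory Num.Theory numFieldNormedType.Exports.
Local Open Scope ring_scope.

(** Write N = 2n + 1 and a_i = (2i + 1) pi / (2N) for 0 <= i < n. Reversing the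
    order of summation turns the F_n of odd index into
    F_n(2k+1) = sum_i (-1)^(i+1) (2 sin a_i)^(2k+1), so the accelerated series
    is an alternating sum over i of the series
      S(t) = sum_k (2 sin t)^(2k+1) / ((2k+1)^2 C(2k,k))
    at t = a_i. The whole formula rests on one expansion, valid on ]0, pi/2[:
      S(t) = 2 t ln(tan(t/2)) + 4 sum_k sin((2k+1)t) / (2k+1)^2.
    Both sides vanish at 0. The arcsine series gives S'(t) = 2t / sin t, and
    ln(tan(t/2)) has derivative 1 / sin t and Fourier series
    -2 sum_k cos((2k+1)t) / (2k+1), so the two derivatives agree.

    To avoid termwise differentiation, only partial sums are differentiated.
    The two partial sums of length M, minus the logarithmic term, form
    [expansion_error]. Its derivative is O(1/M) uniformly on compact subsets of
    ]0, pi/2[ ([arcsine_dsum_approx], [cosine_sum_approx]), which handles the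
    increment of the error between two points; near 0 the error itself is small
    uniformly in M ([expansion_error_small]). Hence it tends to 0
    ([cvg_expansion_error]).

    Summing the expansion over the angles, the logarithms assemble into
    (pi / N) ln u_n ([ln_accel_u]). For the sines, sum_i (-1)^(i+1) sin(m a_i)
    telescopes for odd m once it is multiplied by 2 cos(m pi / (2N)); it
    equals (-1)^n sin(m pi / 2) / 2 unless that cosine vanishes, that is unless
    N divides m, and the exceptional m = N (2l + 1) add up to a second copy of
    G scaled by 1 / N ([alternating_sine_sum]). For n odd the total is
    -(1 + 1/N) G / 2, and solving for G gives the formula.

    That u_n is a unit is a statement about each tangent: multiplying the angle
    by the odd number N turns it into an odd multiple of pi / 4, and the
    multiple angle formulas then give a monic integral equation
    ([integral_tan]); the inverse of the tangent is the tangent of the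
    complementary angle, which is of the same kind. *)

(** * Algebraic units and tangents *)

Lemma algebraic_unitM (K : fieldType) (x y : K) :
  algebraic_unit x -> algebraic_unit y -> algebraic_unit (x * y).
Proof.
move=> [x0 xi xVi] [y0 yi yVi]; split; first by rewrite mulf_neq0.
- exact: integral_mul.
- by rewrite invfM; exact: integral_mul.
Qed.

Lemma algebraic_unit1 (K : fieldType) : algebraic_unit (1 : K).
Proof. by split; rewrite ?invr1 ?oner_neq0 //; apply: integral1. Qed.

Lemma algebraic_unitV (K : fieldType) (x : K) :
  algebraic_unit x -> algebraic_unit x^-1.
Proof. by move=> [x0 xi xVi]; split; rewrite ?invr_eq0 ?invrK. Qed.

Lemma algebraic_unitX (K : fieldType) (x : K) k :
  algebraic_unit x -> algebraic_unit (x ^+ k).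
Proof.
move=> xu; elim: k => [|k IHk]; first exact: algebraic_unit1.
by rewrite exprS; exact: algebraic_unitM.
Qed.

Lemma algebraic_unit_exprz (K : fieldType) (x : K) (z : int) :
  algebraic_unit x -> algebraic_unit (x ^ z).
Proof.
by case: z => k xu; [|apply: algebraic_unitV]; exact: algebraic_unitX.
Qed.

Lemma sin_natpi (R : realType) n : sin (n%:R * pi) = 0 :> R.
Proof. by rewrite mulr_natl -[_ *+ n]add0r (alternatingn (@sinDpi R)) sin0 mulr0. Qed.

Lemma cos_natpi (R : realType) n : cos (n%:R * pi) = (-1) ^+ n :> R.
Proof. by rewrite mulr_natl -[_ *+ n]add0r (alternatingn (@cosDpi R)) cos0 mulr1. Qed.

(** Induction on m by steps of 2x, where cos 2x and sin 2x are cos^2 x times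
    1 - tan^2 x and 2 tan x. The sign (-1)^m is taken out so that A stays
    monic. *)
Lemma tan_multiple_poly (R : realType) m : exists A B : {poly int},
  [/\ A \is monic, size A = (2 * m + 2)%N, (size B <= 2 * m + 1)%N &
    forall x : R, cos x != 0 ->
      sin ((2 * m%:R + 1) * x) =
        (-1) ^+ m * cos x ^+ (2 * m + 1) * (map_poly intr A).[tan x] /\
      cos ((2 * m%:R + 1) * x) =
        (-1) ^+ m * cos x ^+ (2 * m + 1) * (map_poly intr B).[tan x]].
Proof.
elim: m => [|m [A [B [Am sA sB AB]]]].
  exists 'X, 1; split; rewrite ?monicX ?size_polyX ?size_poly1 // => x x0.
  rewrite mulr0 add0r !mul1r map_polyX hornerX rmorph1 hornerC /tan expr1.
  by rewrite mulr1 mulrC divfK.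
have sX2 : size ('X^2 - 1 : {poly int}) = 3%N by rewrite -[1]/(1%:P) size_XnsubC.
have mX2 : ('X^2 - 1 : {poly int}) \is monic by rewrite -[1]/(1%:P) monicXnsubC.
have A0 : A != 0 by rewrite -size_poly_eq0 sA addn2.
have sXA : size (A * ('X^2 - 1)) = (2 * m.+1 + 2)%N.
  by rewrite size_Mmonic // sA sX2; lia.
have sBX : (size (B * 'X *+ 2) <= 2 * m.+1)%N.
  rewrite -scaler_nat (leq_trans (size_scale_leq _ _)) //.
  rewrite (leq_trans (size_polyMleq _ _)) // size_polyX -[2%R]/2%N addn2 /=.
  by rewrite mulnS addnC addn2 ltnS -addn1.
exists (A * ('X^2 - 1) - B * 'X *+ 2), (B * ('X^2 - 1) + A * 'X *+ 2); split.
- rewrite monicE lead_coefDl ?size_polyN ?sXA; last first.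
    by rewrite (leq_ltn_trans sBX) // addn2 ltnS leqnSn.
  by rewrite lead_coef_Mmonic // -monicE.
- by rewrite size_polyDl ?size_polyN ?sXA // (leq_ltn_trans sBX) // addn2 ltnS leqnSn.
- rewrite (leq_trans (size_polyD _ _)) // geq_max; apply/andP; split.
    by rewrite (leq_trans (size_polyMleq _ _)) // sX2 addn3 /= mulnS addn1
      add2n !ltnS -addn1.
  rewrite -scaler_nat (leq_trans (size_scale_leq _ _)) //.
  by rewrite size_mulX // sA mulnS addn2 addn1 add2n.
- move=> x x0; have [Ax Bx] := AB x x0.
  have -> : (2 * m.+1%:R + 1) * x = (2 * m%:R + 1) * x + x *+ 2.
    by rewrite -natr1; ring.
  rewrite (sinD (_ * x)) (cosD (_ * x)) Ax Bx cos_mulr2n sin_mulr2n.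
  have -> : (2 * m.+1 + 1 = (2 * m + 1).+2)%N by lia.
  have cs : sin x = cos x * tan x by rewrite /tan mulrC divfK.
  have c2 : cos x ^+ 2 *+ 2 - 1 = cos x ^+ 2 * (1 - tan x ^+ 2).
    have := cos2Dsin2 x; rewrite cs; lra.
  rewrite c2 {}cs !rmorphD !rmorphN /= !rmorphMn !rmorphM /= !rmorphB /= map_polyX.
  rewrite !rmorph1 map_polyXn.
  rewrite !(hornerD, hornerN, hornerMn, hornerM, hornerXn, hornerX, hornerC).
  rewrite ![_ ^+ _.+1]exprS; move: (cos x) (tan x) ((-1) ^+ m) => c t e.
  move: (c ^+ (2 * m + 1)) (_.[t]) (_.[t]) => ck a b.
  by split; ring.
Qed.

(** Eliminating the angle from cos^2 = sin^2 at an odd multiple of x leaves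
    a monic integral equation A^2 = B^2 for the tangent. *)
Lemma integral_tan (R : realType) m (x : R) : cos x != 0 ->
  cos ((2 * m%:R + 1) * x *+ 2) = 0 -> algebraic_integer (tan x).
Proof.
move=> x0; have [A [B [Am sA sB /(_ x x0)[Ax Bx]]]] := tan_multiple_poly R m.
rewrite cos_mulr2n => H.
exists (A * A - B * B).
  rewrite monicE lead_coefDl ?size_polyN; last first.
    have -> : size (A * A) = (4 * m + 3)%N.
      by rewrite size_Mmonic ?monic_neq0 // sA; lia.
    rewrite (leq_ltn_trans (size_polyMleq _ _)) //.
    by have := leq_add sB sB; move: (_ + size B)%N => b; lia.
  by rewrite -monicE monicMl.
rewrite rmorphB !rmorphM rootE !hornerE /=.
have c0 : ((-1) ^+ m * cos x ^+ (2 * m + 1)) ^+ 2 != 0.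
  by rewrite sqrf_eq0 mulf_neq0 // ?signr_eq0 // expf_neq0.
apply/eqP/(mulfI c0); rewrite mulr0.
have := cos2Dsin2 ((2 * m%:R + 1) * x); rewrite Ax Bx in H *.
move: (_ * _ ^+ _) (_.[_]) (_.[_]) H => k u v H E.
have -> : k ^+ 2 * (u * u - v * v) = (k * u) ^+ 2 - (k * v) ^+ 2 by ring.
lra.
Qed.

(** The inverse of tan x is tan (pi/2 - x), and the hypothesis on x passes to
    pi/2 - x because 2m + 1 is odd. *)
Lemma algebraic_unit_tan (R : realType) m (x : R) : cos x != 0 -> sin x != 0 ->
  cos ((2 * m%:R + 1) * x *+ 2) = 0 -> algebraic_unit (tan x).
Proof.
move=> cx sx x2; split.
- by rewrite /tan mulf_neq0 // invr_eq0.
- exact: integral_tan x2.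
- have cE : cos (pi / 2 - x) = sin x.
    by rewrite cosB cos_pihalf sin_pihalf mul0r add0r mul1r.
  have -> : (tan x)^-1 = tan (pi / 2 - x).
    by rewrite /tan cE sinB cos_pihalf sin_pihalf mul0r subr0 mul1r invf_div.
  apply: (@integral_tan R m); first by rewrite cE.
  have -> : (2 * m%:R + 1) * (pi / 2 - x) *+ 2 =
     (2 * m + 1)%:R * pi - (2 * m%:R + 1) * x *+ 2.
    by rewrite natrD natrM; field.
  by rewrite cosB x2 sin_natpi mulr0 mul0r addr0.
Qed.

(** * Differentiation and elementary bounds *)

(** The derivation rules for functions given by a lambda rather than as a sum
   or product in the ring of functions. *)
Lemma is_deriveDf (R : realType) (f g : R -> R) (x a b : R) :
  is_derive x 1 f a -> is_derive x 1 g b ->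
  is_derive x 1 (fun t => f t + g t) (a + b).
Proof. by move=> df dg; exact: is_deriveD. Qed.

Lemma is_deriveMf (R : realType) (f g : R -> R) (x a b : R) :
  is_derive x 1 f a -> is_derive x 1 g b ->
  is_derive x 1 (fun t => f t * g t) (a * g x + f x * b).
Proof.
move=> df dg; rewrite addrC [a * _]mulrC.
exact: (is_deriveM df dg).
Qed.

Lemma is_deriveZf (R : realType) (f : R -> R) (k x a : R) :
  is_derive x 1 f a -> is_derive x 1 (fun t => k * f t) (k * a).
Proof. by move=> df; exact: (is_deriveZ k df). Qed.

Lemma is_deriveXf (R : realType) (f : R -> R) k (x a : R) :
  is_derive x 1 f a ->
  is_derive x 1 (fun t => f t ^+ k.+1) (k.+1%:R * f x ^+ k * a).
Proof.
move=> df; have := is_deriveX k.+1 df.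
by rewrite (_ : f ^+ k.+1 = fun t => f t ^+ k.+1) //; apply/funext => t; rewrite exprfctE.
Qed.

Lemma is_derive_bigsum (R : realType) (f : nat -> R -> R) (df : nat -> R) M (x : R) :
  (forall k, is_derive x 1 (f k) (df k)) ->
  is_derive x 1 (fun t => \sum_(0 <= k < M) f k t) (\sum_(0 <= k < M) df k).
Proof.
move=> dk; elim: M => [|M IHM].
  rewrite big_geq // (_ : (fun _ => _) = cst 0); first exact: is_derive_cst.
  by apply/funext => t; rewrite big_geq.
rewrite big_nat_recr //=.
rewrite (_ : (fun _ => _) =
  fun t => \sum_(0 <= k < M) f k t + f M t); first exact: is_deriveDf.
by apply/funext => t; rewrite big_nat_recr.
Qed.

Lemma is_derive_scale (R : realType) (f : R -> R) (k x a : R) :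
  is_derive (k * x) 1 f a -> is_derive x 1 (fun t => f (k * t)) (a * k).
Proof.
move=> df; apply: (is_derive1_comp (g := fun t => k * t) df).
by rewrite -[X in is_derive _ _ _ X]mulr1; exact: is_deriveZf.
Qed.

Lemma norm_increment_le (R : realType) (f df : R -> R) (a b C : R) : a <= b ->
  (forall x, a <= x <= b -> is_derive x 1 f (df x)) ->
  (forall x, a <= x <= b -> `|df x| <= C) -> `|f b - f a| <= C * (b - a).
Proof.
move=> ab fdf dfC; have [||c] := @MVT_segment R f df a b ab.
- by move=> x; rewrite in_itv /= => /andP[/ltW ax /ltW xb]; apply: fdf; rewrite ax.
- by apply: derivable_within_continuous => x; rewrite in_itv /= => /fdf[].
rewrite in_itv /= => /dfC cC ->.
by rewrite normrM [X in _ * X]ger0_norm ?subr_ge0 // ler_wpM2r // subr_ge0.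
Qed.

Lemma norm_sin_le (R : realType) (x : R) : 0 <= x -> `|sin x| <= x.
Proof.
move=> x0; rewrite -[X in `|X|]subr0 -[X in _ - X]sin0.
rewrite -[leRHS]mul1r -[X in _ * X]subr0.
by apply: (@norm_increment_le R sin cos) => // t _; exact: cos_max.
Qed.

Lemma le_tan (R : realType) (x : R) : 0 <= x < pi / 2 -> x <= tan x.
Proof.
move=> /andP[x0 xpi].
have cpos t : 0 <= t <= x -> 0 < cos t.
  by move=> /andP[t0 tx]; apply: cos_gt0_pihalf; have := pi_gt0 R; lra.
have [||c] := @MVT_segment R tan (fun t => (cos t) ^- 2) 0 x x0.
- move=> t; rewrite in_itv /= => /andP[t0 tx]; apply: is_derive_tan.
  by rewrite gt_eqF // cpos // !ltW.
- apply: derivable_within_continuous => t; rewrite in_itv /= => tx.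
  by apply: derivable_tan; rewrite gt_eqF // cpos.
rewrite in_itv /= tan0 !subr0 => /cpos c0 ->.
by rewrite -[leLHS]mul1r ler_wpM2r // invf_ge1 ?exprn_gt0 // expr_le1 // ltW.
Qed.

Definition ln_tan_half (R : realType) (t : R) : R := ln (tan (2^-1 * t)).

Lemma is_derive_ln_tan_half (R : realType) (t : R) : 0 < t < pi ->
  is_derive t 1 (@ln_tan_half R) (sin t)^-1.
Proof.
move=> /andP[t0 tpi].
have c0 : 0 < cos (2^-1 * t) by apply: cos_gt0_pihalf; lra.
have s0 : 0 < sin (2^-1 * t) by apply: sin_gt0_pihalf; lra.
have tan0 : 0 < tan (2^-1 * t) by rewrite /tan divr_gt0.
rewrite (_ : (sin t)^-1 =
    (tan (2^-1 * t))^-1 * ((cos (2^-1 * t)) ^- 2 * 2^-1)).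
  apply: (@is_derive1_comp R (@ln R) (fun t => tan (2^-1 * t))).
    exact: is_derive1_ln.
  by apply: is_derive_scale; apply: is_derive_tan; rewrite gt_eqF.
have -> : sin t = sin ((2^-1 * t) *+ 2) by congr (sin _); lra.
rewrite sin_mulr2n /tan; field.
by rewrite !gt_eqF.
Qed.

(** * The partial sums and their derivatives *)

Lemma central_bin_rec k :
  (k.+1 * 'C(2 * k.+1, k.+1) = 2 * (2 * k + 1) * 'C(2 * k, k))%N.
Proof.
have e1 : ((2 * k.+1).-1 = 2 * k + 1)%N by lia.
have := mul_bin_diag (2 * k.+1) k; rewrite e1 => <-.
have := mul_bin_diag (2 * k + 1) k; rewrite addn1 /= -addn1 => rec.
have sym : 'C(2 * k + 1, k.+1) = 'C(2 * k + 1, k).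
  by rewrite -bin_sub; [congr ('C(_, _))|]; lia.
rewrite sym in rec; nia.
Qed.

Lemma central_bin_gt0 (R : realType) k : 0 < 'C(2 * k, k)%:R :> R.
Proof. by rewrite ltr0n bin_gt0; lia. Qed.

(** The recurrence multiplies the left side by (2M+2)/(2M+1), which is at most
    (2M+3)/(2M+1). *)
Lemma central_bin_ge (R : realType) M :
  2 ^+ (2 * M) / 'C(2 * M, M)%:R <= 2 * M%:R + 1 :> R.
Proof.
rewrite ler_pdivrMr ?central_bin_gt0 //.
elim: M => [|M IHM]; first by rewrite muln0 expr0 mulr0 add0r bin0 mulr1.
have := congr1 (fun n => n%:R : R) (central_bin_rec M).
rewrite !natrM natrD natrM -natr1 => rec.
have e : (2 * M.+1 = 2 + 2 * M)%N by lia.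
have := central_bin_gt0 R M.+1; rewrite e in rec * => c0.
rewrite exprD (_ : 2 ^+ 2 = 4); last by rewrite -natrX.
set c' := 'C(2 + 2 * M, _)%:R in rec c0 *; set c := 'C(_, _)%:R in rec IHM.
set p := 2 ^+ (2 * M) in IHM *.
have : 4 * p <= 4 * ((2 * M%:R + 1) * c) by rewrite ler_pM2l.
lra.
Qed.

Section Expansions.
Variable R : realType.
Implicit Types (M : nat) (t : R).

Definition arcsine_sum M t : R := \sum_(0 <= k < M)
  (2 * sin t) ^+ (2 * k + 1) / ((2 * k%:R + 1) ^+ 2 * 'C(2 * k, k)%:R).

(** Equal to tan t times the derivative of [arcsine_sum]; up to a factor of 2
    these are the partial sums of arcsin x / sqrt (1 - x^2) at x = sin t, which
    is why multiplication by cos t makes it close to 2t. *)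
Definition arcsine_dsum M t : R := \sum_(0 <= k < M)
  (2 * sin t) ^+ (2 * k + 1) / ((2 * k%:R + 1) * 'C(2 * k, k)%:R).

Definition sine_sum M t : R :=
  \sum_(0 <= k < M) sin ((2 * k%:R + 1) * t) / (2 * k%:R + 1) ^+ 2.

Definition cosine_sum M t : R :=
  \sum_(0 <= k < M) cos ((2 * k%:R + 1) * t) / (2 * k%:R + 1).

Lemma odd_neq0 k : 2 * k%:R + 1 != 0 :> R.
Proof. by rewrite lt0r_neq0 // ltr_wpDl // mulr_ge0. Qed.

Lemma is_derive_sine_sum M t : is_derive t 1 (sine_sum M) (cosine_sum M t).
Proof.
apply: is_derive_bigsum => k.
have := is_deriveZf R (fun t => sin ((2 * k%:R + 1) * t)) ((2 * k%:R + 1) ^- 2)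
   t _ (is_derive_scale R sin _ t _ (is_derive_sin _)).
rewrite (_ : (fun _ => _) =
  fun t => sin ((2 * k%:R + 1) * t) / (2 * k%:R + 1) ^+ 2); last first.
  by apply/funext => u; rewrite mulrC.
by move/is_derive_eq; apply; field; exact: odd_neq0.
Qed.

Lemma is_derive_cosine_sum M t : is_derive t 1 (cosine_sum M)
  (- \sum_(0 <= k < M) sin ((2 * k%:R + 1) * t)).
Proof.
rewrite -sumrN; apply: is_derive_bigsum => k.
have := is_deriveZf R (fun t => cos ((2 * k%:R + 1) * t)) ((2 * k%:R + 1)^-1)
   t _ (is_derive_scale R cos _ t _ (is_derive_cos _)).
rewrite (_ : (fun _ => _) =
  fun t => cos ((2 * k%:R + 1) * t) / (2 * k%:R + 1)); last first.
  by apply/funext => u; rewrite mulrC.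
by move/is_derive_eq; apply; field; exact: odd_neq0.
Qed.

(** Telescoping by 2 sin t sin((2k+1)t) = cos(2kt) - cos(2(k+1)t). *)
Lemma sum_sin_odd M t : 2 * sin t * (\sum_(0 <= k < M) sin ((2 * k%:R + 1) * t)) =
  1 - cos (2 * M%:R * t).
Proof.
elim: M => [|M IHM]; first by rewrite big_geq // !mulr0 mul0r cos0 subrr.
rewrite big_nat_recr //= mulrDr IHM -[M.+1%:R]natr1.
have -> : 2 * M%:R * t = (2 * M%:R + 1) * t - t by ring.
have -> : 2 * (M%:R + 1) * t = (2 * M%:R + 1) * t + t by ring.
by rewrite cosB cosD; ring.
Qed.

Lemma is_derive_arcsine_sum M t : sin t != 0 ->
  is_derive t 1 (arcsine_sum M) (cos t * arcsine_dsum M t / sin t).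
Proof.
move=> s0; rewrite mulrAC mulr_sumr; apply: is_derive_bigsum => k.
have := is_deriveZf R (fun t => (2 * sin t) ^+ (2 * k).+1)
   ((2 * k%:R + 1) ^+ 2 * 'C(2 * k, k)%:R)^-1 t _
   (is_deriveXf R _ (2 * k) _ _ (is_deriveZf R _ 2 t _ (is_derive_sin t))).
rewrite (_ : (fun _ => _) = fun t =>
  (2 * sin t) ^+ (2 * k + 1) / ((2 * k%:R + 1) ^+ 2 * 'C(2 * k, k)%:R)); last first.
  by apply/funext => u; rewrite mulrC addn1.
move/is_derive_eq; apply.
rewrite addn1 [_ ^+ (2 * k).+1]exprS -[(2 * k).+1%:R]natr1 natrM; field.
by rewrite s0 odd_neq0 gt_eqF ?central_bin_gt0.
Qed.

(** The derivative telescopes by the recurrence for the central binomial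
    coefficients; in the limit cos * arcsine_dsum therefore has derivative 2. *)
Lemma is_derive_cos_arcsine_dsum M t :
  is_derive t 1 (fun t => cos t * arcsine_dsum M t)
    (2 - 2 * ((2 * sin t) ^+ (2 * M) / 'C(2 * M, M)%:R)).
Proof.
have dD : is_derive t 1 (arcsine_dsum M)
   (\sum_(0 <= k < M) 2 * cos t * ((2 * sin t) ^+ (2 * k) / 'C(2 * k, k)%:R)).
  apply: is_derive_bigsum => k.
  have := is_deriveZf R (fun t => (2 * sin t) ^+ (2 * k).+1)
   ((2 * k%:R + 1) * 'C(2 * k, k)%:R)^-1 t _
   (is_deriveXf R _ (2 * k) _ _ (is_deriveZf R _ 2 t _ (is_derive_sin t))).
  rewrite (_ : (fun _ => _) = fun t =>
    (2 * sin t) ^+ (2 * k + 1) / ((2 * k%:R + 1) * 'C(2 * k, k)%:R)); last first.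
    by apply/funext => u; rewrite mulrC addn1.
  move/is_derive_eq; apply.
  rewrite -[(2 * k).+1%:R]natr1 natrM; field.
  by rewrite odd_neq0 gt_eqF ?central_bin_gt0.
apply: is_derive_eq (is_deriveMf R _ _ t _ _ (is_derive_cos t) dD) _.
rewrite /arcsine_dsum; elim: M {dD} => [|M IHM].
  by rewrite !big_geq // muln0 expr0 bin0; field.
rewrite !big_nat_recr //= !mulrDr addrACA IHM.
have rec := congr1 (fun n => n%:R : R) (central_bin_rec M).
rewrite !natrM natrD natrM -natr1 in rec.
have {rec} -> : 'C(2 * M.+1, M.+1)%:R =
    2 * (2 * M%:R + 1) * 'C(2 * M, M)%:R / (M%:R + 1) :> R.
  by rewrite -rec mulrAC mulfV ?mul1r // natr1 pnatr_eq0.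
have c2 := cos2sin2 t.
have -> : (2 * M.+1 = (2 * M).+2)%N by lia.
rewrite addn1 !exprS; move: ((2 * sin t) ^+ (2 * M)) => p.
have M0 : M%:R + 1 != 0 :> R by rewrite natr1 pnatr_eq0.
rewrite mulrCA [cos t * (2 * cos t * _)]mulrA [cos t * (2 * _)]mulrCA -expr2 c2.
field.
by rewrite M0 odd_neq0 gt_eqF ?central_bin_gt0.
Qed.

End Expansions.

(** * Estimates for the sums of sines and cosines *)

Section Estimates.
Variable R : realType.
Implicit Types (K M : nat) (d t x : R).

Lemma sin_gt0_half d : 0 < d <= pi / 2 -> 0 < sin d.
Proof. by move=> dpi; apply: sin_gt0_pi; have := pi_gt0 R; lra. Qed.

Lemma sin_le_half x t : 0 <= x <= t -> t <= pi / 2 -> sin x <= sin t.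
Proof.
move=> xt tpi; have p0 := pi_gt0 R.
have [->//|xNt] := eqVneq x t.
by apply/ltW; rewrite ltr_sin ?in_itv /= ?lt_neqAle ?xNt; lra.
Qed.

(** Comparison with the telescoping series 1 / (k (k+1)). *)
Lemma inv_odd_sqr_tail K M : (0 < K)%N ->
  \sum_(K <= k < K + M) (2 * k%:R + 1) ^- 2 <= K%:R^-1 - (K + M)%:R^-1 :> R.
Proof.
move=> K0; elim: M => [|M IHM]; first by rewrite addn0 big_geq // subrr.
rewrite addnS big_nat_recr ?leq_addr //=.
apply: le_trans (lerD IHM (lexx _)) _.
rewrite -[(K + M).+1%:R]natr1.
have : 0 < (K + M)%:R :> R by rewrite ltr0n; lia.
move: (K + M)%:R => x x0.
suff : (2 * x + 1) ^- 2 <= x^-1 - (x + 1)^-1 by lra.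
have -> : x^-1 - (x + 1)^-1 = (x * (x + 1))^-1 by field; lra.
by rewrite lef_pV2 ?posrE; nra.
Qed.

Lemma inv_odd_sqr_sum_le2 M : \sum_(0 <= k < M) (2 * k%:R + 1) ^- 2 <= 2 :> R.
Proof.
case: M => [|M]; first by rewrite big_geq.
rewrite big_ltn // mulr0 add0r expr1n invr1.
have := @inv_odd_sqr_tail 1 M isT; rewrite add1n invr1.
have : 0 <= M.+1%:R^-1 :> R by rewrite invr_ge0.
by move: (\sum_(1 <= k < _) _) M.+1%:R^-1 => S y; lra.
Qed.

(** The first K terms are at most d each, by |sin x| <= |x|, and the remaining
    ones are bounded by the tail of the series of inverse squares. With
    d = 1 / K^2 this is small uniformly in M. *)
Lemma sine_sum_small K M d : (0 < K)%N -> 0 <= d ->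
  `|sine_sum R M d| <= K%:R * d + K%:R^-1.
Proof.
move=> K0 d0.
have odd1 k : 1 <= 2 * k%:R + 1 :> R by rewrite lerDr mulr_ge0.
have small N : \sum_(0 <= k < N)
   `|sin ((2 * k%:R + 1) * d) / (2 * k%:R + 1) ^+ 2| <= N%:R * d.
  have -> : N%:R * d = \sum_(0 <= k < N) d by rewrite sumr_const_nat subn0 mulr_natl.
  apply: ler_sum => k _; rewrite normrM normfV [X in _ / X]ger0_norm ?sqr_ge0 //.
  have o := odd1 k; have o0 : 0 < 2 * k%:R + 1 :> R by lra.
  rewrite ler_pdivrMr ?exprn_gt0 //.
  apply: le_trans (norm_sin_le R _ _) _; first by rewrite mulr_ge0 // ltW.
  rewrite mulrC ler_wpM2l // -[leLHS]mulr1 expr2 ler_wpM2l // ltW //.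
rewrite /sine_sum; apply: le_trans (ler_norm_sum _ _ _) _.
have [MK|KM] := leqP M K.
  apply: le_trans (small M) _; rewrite -[leLHS]addr0 lerD ?invr_ge0 //.
  by rewrite ler_wpM2r // ler_nat.
rewrite (big_cat_nat _ (n := K)) //=; last exact: ltnW.
apply: lerD; first exact: small.
have := inv_odd_sqr_tail K (M - K) K0; rewrite subnKC; last exact: ltnW.
have M0 : 0 <= M%:R^-1 :> R by rewrite invr_ge0.
suff : \sum_(K <= k < M) `|sin ((2 * k%:R + 1) * d) / (2 * k%:R + 1) ^+ 2| <=
   \sum_(K <= k < M) (2 * k%:R + 1) ^- 2 :> R by lra.
apply: ler_sum => k _; rewrite normrM normfV [X in _ / X]ger0_norm ?sqr_ge0 //.
by rewrite -[leRHS]mul1r ler_wpM2r ?sin_max // invr_ge0 sqr_ge0.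
Qed.

(** For d <= 1/4 the quantity 2 sin d is at most 1, so each power is at most
    its first one and the inverse squares do the rest. *)
Lemma arcsine_sum_small M d : 0 <= d <= 4^-1 -> `|arcsine_sum R M d| <= 4 * d.
Proof.
move=> /andP[d0 d4].
have p2 := pi_ge2 R.
have s0 : 0 <= sin d by apply: sin_ge0_pi; lra.
have sd : sin d <= d by have := norm_sin_le R d d0; rewrite ger0_norm.
have t0 k : 0 <= (2 * sin d) ^+ (2 * k + 1) /
   ((2 * k%:R + 1) ^+ 2 * 'C(2 * k, k)%:R).
  rewrite divr_ge0 ?exprn_ge0 ?mulr_ge0 ?sqr_ge0 //.
rewrite ger0_norm ?sumr_ge0 // /arcsine_sum.
apply: (@le_trans _ _ (\sum_(0 <= k < M) 2 * d * (2 * k%:R + 1) ^- 2)); last first.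
  rewrite -mulr_sumr; have := inv_odd_sqr_sum_le2 M; nra.
apply: ler_sum => k _; apply: ler_pM => //.
- by rewrite exprn_ge0 // mulr_ge0.
- rewrite addn1 exprS -[leRHS]mulr1 ler_pM ?mulr_ge0 ?exprn_ge0 ?mulr_ge0 //.
    by rewrite ler_wpM2l.
  by rewrite exprn_ile1 ?mulr_ge0 //; lra.
- have odd0 : 0 < (2 * k%:R + 1) ^+ 2 :> R.
    by rewrite exprn_gt0 // ltr_wpDl // mulr_ge0.
  rewrite lef_pV2 ?posrE ?mulr_gt0 ?central_bin_gt0 //.
  rewrite -[leLHS]mulr1; apply: ler_wpM2l; first exact: ltW.
  by rewrite ler1n bin_gt0; lia.
Qed.

(** The argument d = 1 / K^2 satisfies d/2 <= tan (d/2) <= 1, so the logarithm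
    is at most ln ((2K)^2) in absolute value. *)
Lemma ln_tan_half_small K : (1 < K)%N ->
  `|ln_tan_half R (K%:R ^- 2)| <= 4 * K%:R.
Proof.
move=> K1; have K2 : 2 <= K%:R :> R by rewrite ler_nat.
have p2 := pi_ge2 R.
set d : R := K%:R ^- 2.
have d0 : 0 < d by rewrite invr_gt0 exprn_gt0 //; lra.
have d4 : d <= 4^-1.
  by rewrite lef_pV2 ?posrE ?exprn_gt0 //; [rewrite expr2; nra|lra].
have tge : 2^-1 * d <= tan (2^-1 * d) by apply: le_tan; lra.
have tlt : tan (2^-1 * d) <= 1.
  rewrite -[leRHS](tan_piquarter R) ltW // ltr_tan ?in_itv /=; lra.
rewrite /ln_tan_half; move: (tan _) tge tlt => x tge x1.
have x0 : 0 < x by lra.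
rewrite ler0_norm ?ln_le0 // -lnV ?posrE //.
apply: (@le_trans _ _ (ln ((2 * K%:R) ^+ 2))).
  rewrite ler_ln ?posrE ?invr_gt0 ?exprn_gt0 ?mulr_gt0 //; last by lra.
  rewrite -[leRHS]invrK lef_pV2 ?posrE ?invr_gt0 ?exprn_gt0 ?mulr_gt0 //; try lra.
  apply: le_trans tge; rewrite exprMn invfM -/d ler_wpM2r ?(ltW d0) //.
  by rewrite lef_pV2 ?posrE // -natrX; lra.
rewrite lnXn ?mulr_gt0 //; last by lra.
have : ln (2 * K%:R) < 2 * K%:R :> R by apply: ln_sublinear; rewrite mulr_gt0 //; lra.
lra.
Qed.

(** Comparing with sin(2Mt)/(M sin t) turns the oscillating derivative
    2cos(2Mt)/sin t into one of size O(1/M). *)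
Lemma cosine_sum_approx M d t : (0 < M)%N -> 0 < d <= t -> t <= pi / 2 ->
  `|2 * ln_tan_half R t + 4 * cosine_sum R M t| <= 3 / (sin d) ^+ 2 / M%:R.
Proof.
move=> M_gt0 /andP[d0 dt] tpi; have p0 := pi_gt0 R.
have M0 : 0 < M%:R :> R by rewrite ltr0n.
have sd0 : 0 < sin d by apply: sin_gt0_half; lra.
have sd x : t <= x <= pi / 2 -> sin d <= sin x.
  by move=> /andP[tx xpi]; apply: sin_le_half; lra.
have s0 x : t <= x <= pi / 2 -> 0 < sin x by move=> /sd; lra.
(* A primitive of the oscillating derivative up to a term of order 1/M; it
   also vanishes at pi/2. *)
pose osc x := sin (2 * M%:R * x) * (M%:R * sin x)^-1.
pose f x := 2 * ln_tan_half R x + 4 * cosine_sum R M x - osc x.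
have tt : t <= t <= pi / 2 by rewrite lexx.
have st0 : 0 < sin t := s0 t tt.
have osc_le : `|osc t| <= (sin d ^+ 2)^-1 / M%:R.
  rewrite /osc invfM [_^-1 * _]mulrC mulrA normrM [`|_^-1|]gtr0_norm ?invr_gt0 //.
  rewrite ler_wpM2r ?invr_ge0 ?(ltW M0) // normrM [`|_^-1|]gtr0_norm ?invr_gt0 //.
  apply: (@le_trans _ _ (sin t)^-1).
    by rewrite ler_piMl ?sin_max // invr_ge0 ltW.
  have := sd t tt => st; have := sin_le1 d => s1.
  by rewrite lef_pV2 ?posrE ?exprn_gt0 //; rewrite expr2; nra.
have fpi : f (pi / 2) = 0.
  rewrite /f /osc (_ : 2 * M%:R * (pi / 2) = M%:R * pi); last by field.
  rewrite sin_natpi mul0r subr0 /ln_tan_half.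
  have -> : 2^-1 * (pi / 2) = pi / 4 :> R by field.
  rewrite tan_piquarter ln1 mulr0 add0r /cosine_sum big1 ?mulr0 // => k _.
  have -> : (2 * k%:R + 1) * (pi / 2) = pi / 2 + k%:R * pi :> R by field.
  by rewrite cosD cos_pihalf sin_natpi mulr0 mul0r subr0 mul0r.
have df x : t <= x <= pi / 2 -> is_derive x 1 f
    (sin (2 * M%:R * x) * cos x / (M%:R * sin x ^+ 2)).
  move=> xt; have sx := s0 _ xt; have sxN0 : sin x != 0 by rewrite gt_eqF.
  have dl := is_derive_ln_tan_half R x.
  have {}dl : is_derive x 1 (@ln_tan_half R) (sin x)^-1 by apply: dl; lra.
  have d1 := is_deriveDf R _ _ x _ _ (is_deriveZf R _ 2 x _ dl)
               (is_deriveZf R _ 4 x _ (is_derive_cosine_sum R M x)).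
  have dV : is_derive x 1 (fun x => (M%:R * sin x)^-1)
      (- (M%:R * sin x) ^- 2 * (M%:R * cos x)).
    by apply: is_deriveV; rewrite mulf_neq0 // gt_eqF.
  have d2 := is_deriveMf R _ _ x _ _
    (is_derive_scale R sin (2 * M%:R) x _ (is_derive_sin _)) dV.
  have d3 := is_deriveDf R _ _ x _ _ d1 (is_deriveZf R _ (-1) x _ d2).
  rewrite (_ : f = fun t => 2 * ln_tan_half R t + 4 * cosine_sum R M t +
     -1 * (sin (2 * M%:R * t) / (M%:R * sin t))); last first.
    by apply/funext => u; rewrite mulN1r.
  apply: is_derive_eq d3 _.
  have := sum_sin_odd R M x; move: (\sum_(0 <= k < M) _) => S eS.
  have {eS} -> : S = (1 - cos (2 * M%:R * x)) / (2 * sin x).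
    by rewrite -eS; field.
  by field; rewrite sxN0 gt_eqF.
have : `|f (pi / 2) - f t| <= (sin d ^+ 2)^-1 / M%:R * (pi / 2 - t).
  apply: norm_increment_le tpi df _ => x xt.
  have sx := s0 _ xt.
  rewrite invfM mulrCA mulrC normrM [`|_^-1|]gtr0_norm ?invr_gt0 //.
  rewrite ler_wpM2r ?invr_ge0 ?(ltW M0) // normrM.
  rewrite [`|_^-1|]gtr0_norm ?invr_gt0 ?exprn_gt0 //.
  apply: (@le_trans _ _ (sin x ^+ 2)^-1).
    rewrite ler_piMl ?invr_ge0 ?sqr_ge0 // normrM.
    by rewrite mulr_ile1 ?sin_max ?cos_max.
  rewrite lef_pV2 ?posrE ?exprn_gt0 //.
  by have := sd x xt; rewrite !expr2; nra.
rewrite fpi sub0r normrN => f_le.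
have -> : 2 * ln_tan_half R t + 4 * cosine_sum R M t = f t + osc t by rewrite subrK.
apply: le_trans (ler_normD _ _) _.
apply: le_trans (lerD f_le osc_le) _.
rewrite -[leRHS]mulrA; set c := (_^-1 / M%:R).
have c0 : 0 <= c by rewrite divr_ge0 ?invr_ge0 ?sqr_ge0 // ltW.
have := pihalf_lt2 R; move: c c0 => c c0 pi2.
by apply: (@le_trans _ _ (c * 2 + c)); [rewrite lerD2r ler_wpM2l|]; lra.
Qed.

End Estimates.

(** * The expansion of the arcsine sum *)

Section Limit.
Local Open Scope classical_set_scope.
Local Open Scope ring_scope.
Variable R : realType.
Implicit Types (K M : nat) (d t x : R).

(** Bernoulli's inequality in the form s^N (1 + (1-s) N) <= 1. *)
Lemma expr_le_inv s M : 0 <= s < 1 -> (0 < M)%N ->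
  s ^+ M <= ((1 - s) * M%:R)^-1 :> R.
Proof.
move=> /andP[s0 s1] M0; have M_gt0 : 0 < M%:R :> R by rewrite ltr0n.
suff bern N : s ^+ N * (1 + (1 - s) * N%:R) <= 1.
  have p0 : 0 <= s ^+ M by rewrite exprn_ge0.
  rewrite -[leRHS]mul1r ler_pdivlMr; last by nra.
  by apply: le_trans (bern M); rewrite ler_wpM2l // lerDr.
elim: N => [|N IHN]; first by rewrite expr0 mulr0 addr0 mulr1.
apply: le_trans IHN; rewrite exprS -[N.+1%:R]natr1.
have p0 : 0 <= s ^+ N by rewrite exprn_ge0.
have N0 : 0 <= N%:R :> R by [].
rewrite [s * _]mulrC -mulrA ler_wpM2l //.
suff : 0 <= (1 - s) ^+ 2 * (N%:R + 1) by lra.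
by rewrite mulr_ge0 ?sqr_ge0 // addr_ge0.
Qed.

(** One factor s^M absorbs the linear growth of 4^M / C(2M,M), the other one
    leaves the decay in 1/M. *)
Lemma central_bin_power_le s M : 0 <= s < 1 -> (0 < M)%N ->
  (2 * s) ^+ (2 * M) / 'C(2 * M, M)%:R <= 3 / (1 - s) ^+ 2 / M%:R :> R.
Proof.
move=> s01 M0; have /andP[s0 s1] := s01.
have M1 : 1 <= M%:R :> R by rewrite ler1n.
rewrite exprMn mulrAC.
apply: (@le_trans _ _ ((3 * M%:R) * ((1 - s) * M%:R)^-1 ^+ 2)).
  apply: ler_pM.
  - by rewrite divr_ge0 ?exprn_ge0.
  - by rewrite exprn_ge0.
  - by apply: le_trans (central_bin_ge R M) _; lra.
  - by rewrite mulnC exprM lerXn2r ?nnegrE ?exprn_ge0 ?expr_le_inv // invr_ge0; nra.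
rewrite (_ : _ * _ = 3 / (1 - s) ^+ 2 / M%:R) //; field.
by apply/andP; split; rewrite lt0r_neq0 //; lra.
Qed.

(** The difference vanishes at 0 and its derivative is
    -2 (2 sin x)^(2M) / C(2M,M), which [central_bin_power_le] bounds on
    [0, t] because sin x <= sin t < 1. *)
Lemma arcsine_dsum_approx M x t : (0 < M)%N -> 0 <= x <= t -> t < pi / 2 ->
  `|cos x * arcsine_dsum R M x - 2 * x| <= 12 / (1 - sin t) ^+ 2 / M%:R.
Proof.
move=> M0 /andP[x0 xt] tpi; have p0 := pi_gt0 R; have p2 := pihalf_lt2 R.
have st0 : 0 <= sin t by apply: sin_ge0_pi; lra.
have st1 : sin t < 1.
  by rewrite -[ltRHS](sin_pihalf R) ltr_sin ?in_itv /=; lra.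
pose g y : R := cos y * arcsine_dsum R M y + (-2) * y.
have dg y : 0 <= y <= x -> is_derive y 1 g
    (- 2 * ((2 * sin y) ^+ (2 * M) / 'C(2 * M, M)%:R)).
  move=> _; apply: is_derive_eq (is_deriveDf R _ _ y _ _
    (is_derive_cos_arcsine_dsum R M y) (is_deriveZf R _ (-2) y _ (is_derive_id y 1))) _.
  by lra.
have g0 : g 0 = 0.
  rewrite /g mulr0 addr0 /arcsine_dsum big1 ?mulr0 // => k _.
  by rewrite sin0 mulr0 addn1 expr0n mul0r.
set c := 3 / (1 - sin t) ^+ 2 / M%:R.
have : `|g x - g 0| <= 2 * c * (x - 0).
  apply: norm_increment_le x0 dg _ => y /andP[y0 yx].
  have sy0 : 0 <= sin y by apply: sin_ge0_pi; lra.
  have syt : sin y <= sin t by apply: sin_le_half; lra.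
  rewrite normrM normrN !ger0_norm ?divr_ge0 ?exprn_ge0 ?mulr_ge0 //.
  rewrite ler_wpM2l //; apply: le_trans (central_bin_power_le (sin t) _ _ M0).
    rewrite ler_wpM2r ?invr_ge0 // lerXn2r ?nnegrE ?mulr_ge0 // ler_wpM2l //.
  by rewrite st0.
rewrite g0 !subr0 {1}/g mulNr => le_c; apply: le_trans le_c _.
have c0 : 0 <= c by rewrite !divr_ge0 ?sqr_ge0.
have -> : 12 / (1 - sin t) ^+ 2 / M%:R = 2 * c * 2 by rewrite /c; lra.
by rewrite ler_wpM2l ?mulr_ge0 //; lra.
Qed.

Definition expansion_error M t : R :=
  arcsine_sum R M t - 4 * sine_sum R M t - 2 * t * ln_tan_half R t.

(** The derivative of the error splits into the two defects bounded by
    [arcsine_dsum_approx] and [cosine_sum_approx], both O(1/M) on [d, t]. *)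
Lemma expansion_error_increment d t : 0 < d <= t -> t < pi / 2 ->
  exists C, forall M, (0 < M)%N ->
    `|expansion_error M t - expansion_error M d| <= C / M%:R.
Proof.
move=> /andP[d0 dt] tpi; have p0 := pi_gt0 R; have p2 := pihalf_lt2 R.
have sd0 : 0 < sin d by apply: sin_gt0_half; lra.
pose A := 12 / (1 - sin t) ^+ 2 / sin d; pose B : R := 3 / (sin d) ^+ 2.
exists ((A + B) * (t - d)) => M M0.
rewrite mulrAC.
pose df x := cos x * arcsine_dsum R M x / sin x - 4 * cosine_sum R M x
   - 2 * ln_tan_half R x - 2 * x / sin x.
apply: (norm_increment_le R (expansion_error M) df) => // x /andP[dx xt].
  have sx0 : 0 < sin x by apply: sin_gt0_half; lra.
  have sxN0 : sin x != 0 by rewrite gt_eqF.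
  have dl : is_derive x 1 (@ln_tan_half R) (sin x)^-1.
    by apply: is_derive_ln_tan_half; lra.
  have d1 := is_deriveDf R _ _ x _ _ (is_derive_arcsine_sum R M x sxN0)
     (is_deriveZf R _ (-4) x _ (is_derive_sine_sum R M x)).
  have d2 := is_deriveDf R _ _ x _ _ d1 (is_deriveZf R _ (-2) x _
     (is_deriveMf R _ _ x _ _ (is_derive_id x 1) dl)).
  rewrite (_ : expansion_error M = fun t => arcsine_sum R M t +
    (-4) * sine_sum R M t + (-2) * (t * ln_tan_half R t)); last first.
    by apply/funext => u; rewrite !mulNr mulrA.
  by apply: is_derive_eq d2 _; rewrite /df; lra.
have -> : df x = (cos x * arcsine_dsum R M x - 2 * x) / sin x -
     (2 * ln_tan_half R x + 4 * cosine_sum R M x) by rewrite /df; lra.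
have sx0 : 0 < sin x by apply: sin_gt0_half; lra.
have sdx : sin d <= sin x by apply: sin_le_half; lra.
apply: le_trans (ler_normB _ _) _; rewrite [leRHS]mulrDl; apply: lerD.
  rewrite normrM [`|_^-1|]gtr0_norm ?invr_gt0 // /A [leRHS]mulrAC.
  apply: ler_pM; rewrite ?invr_ge0 ?(ltW sx0) //.
    by apply: arcsine_dsum_approx => //; lra.
  by rewrite lef_pV2 ?posrE.
by apply: cosine_sum_approx => //; lra.
Qed.

(** At 1 / K^2 each of the three terms of the error is O(1/K) whatever M is,
    which replaces evaluating the limit at 0. *)
Lemma expansion_error_small K M : (1 < K)%N ->
  `|expansion_error M (K%:R ^- 2)| <= 20 / K%:R.
Proof.
move=> K1; have K0 : (0 < K)%N by exact: ltnW.
have K2 : 2 <= K%:R :> R by rewrite ler_nat.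
have Kn0 : K%:R != 0 :> R by lra.
have Ki : K%:R^-1 <= 2^-1 :> R by rewrite lef_pV2 ?posrE //; lra.
have Kp : 0 < K%:R^-1 :> R by rewrite invr_gt0; lra.
have dE : K%:R ^- 2 = K%:R^-1 * K%:R^-1 :> R by rewrite expr2 invfM.
have d0 : 0 <= K%:R ^- 2 :> R by rewrite invr_ge0 sqr_ge0.
have d4 : K%:R ^- 2 <= 4^-1 :> R by rewrite dE; nra.
have a : `|arcsine_sum R M (K%:R ^- 2)| <= 4 * K%:R ^- 2.
  by apply: arcsine_sum_small; rewrite d0.
have b := sine_sum_small R K M _ K0 d0.
have l := ln_tan_half_small R K K1.
have Kd : K%:R * K%:R ^- 2 = K%:R^-1 :> R by rewrite dE mulrA mulfV ?mul1r.
have {}l : `|2 * K%:R ^- 2 * ln_tan_half R (K%:R ^- 2)| <= 8 * K%:R^-1.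
  rewrite normrM ger0_norm ?mulr_ge0 //.
  apply: (@le_trans _ _ (2 * K%:R ^- 2 * (4 * K%:R))).
    by rewrite ler_wpM2l // mulr_ge0.
  by rewrite -Kd; lra.
rewrite /expansion_error; apply: le_trans (ler_normB _ _) _.
apply: le_trans (lerD (ler_normB _ _) (lexx _)) _.
rewrite [`|4 * _|]normrM (ger0_norm (_ : 0 <= 4)) //.
rewrite Kd in b.
have d2 : K%:R ^- 2 <= K%:R^-1 :> R by rewrite dE; nra.
lra.
Qed.

(** Choosing K first makes the error at 1 / K^2 smaller than e/2, uniformly in
    M; then M large makes the increment from 1 / K^2 to t smaller than e/2. *)
Lemma cvg_expansion_error t : 0 < t < pi / 2 ->
  expansion_error M t @[M --> \oo] --> 0.
Proof.
move=> /andP[t0 tpi]; apply/cvgrPdist_le => e e0.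
have [K [K1 Kt Ke]] : exists K, [/\ (1 < K)%N, K%:R ^- 2 <= t & 20 / K%:R <= e / 2].
  (* K^2 >= 1/t puts 1 / K^2 below t, and 40/e <= K gives 20/K <= e/2. *)
  have [K K1 lK] : exists2 K, (1 < K)%N & t^-1 + 40 / e <= K%:R.
    exists (Num.truncn (t^-1 + 40 / e)).+2 => //.
    by apply/ltW/(lt_trans (truncnS_gt _)); rewrite ltr_nat.
  exists K.
  have ti : 0 < t^-1 by rewrite invr_gt0.
  have ei : 0 < 40 / e by rewrite divr_gt0.
  have K0 : 1 <= K%:R :> R by rewrite ler1n ltnW.
  split=> //.
  - rewrite -[leRHS]invrK lef_pV2 ?posrE ?exprn_gt0 //; last by lra.
    by rewrite expr2; nra.
  - rewrite ler_pdivrMr; last by lra.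
    have : e * (40 / e) = 40 by field; lra.
    nra.
have K0 : 0 < K%:R :> R by rewrite ltr0n; exact: ltnW.
have d0 : (0 : R) < K%:R ^- 2 <= t by rewrite Kt andbT invr_gt0 exprn_gt0.
have [C CM] := expansion_error_increment _ t d0 tpi.
near=> M.
rewrite sub0r normrN -(subrK (expansion_error M (K%:R ^- 2)) (expansion_error M t)).
apply: le_trans (ler_normD _ _) _; rewrite [e]splitr; apply: lerD; last first.
  exact: le_trans (expansion_error_small K M K1) Ke.
have M0 : (0 < M)%N by near: M; exists 1%N.
apply: le_trans (CM M M0) _.
rewrite ler_pdivrMr ?ltr0n //.
have : 2 * C / e <= M%:R by near: M; exact: nbhs_infty_ger.
rewrite ler_pdivrMr //; lra.
Unshelve. all: by end_near. Qed.

End Limit.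

(** * Alternating sums of sines over the angles *)

Section Angles.
Variable R : realType.
Implicit Types (n i k l M : nat).

Definition odd_angle n i : R := (2 * i%:R + 1) * pi / (4 * n%:R + 2).

Lemma odd_angle_bounds n i : (i < n)%N -> 0 < odd_angle n i < pi / 2.
Proof.
move=> lt_in; have p0 := pi_gt0 R.
have i0 : 0 <= i%:R :> R by [].
have lt_inR : i%:R + 1 <= n%:R :> R by rewrite natr1 ler_nat.
have d0 : 0 < 4 * n%:R + 2 :> R by lra.
rewrite /odd_angle; apply/andP; split.
  by rewrite divr_gt0 // mulr_gt0 //; lra.
by rewrite ltr_pdivrMr // mulrC ; nra.
Qed.

(** Since 2 cos b sin((2i+1)b) = sin(2(i+1)b) + sin(2ib), the alternating signs
    make the sum telescope. *)
Lemma sin_alternating_telescope n (b : R) :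
  2 * cos b * (\sum_(0 <= i < n) (-1) ^+ i.+1 * sin ((2 * i%:R + 1) * b)) =
  (-1) ^+ n * sin (2 * n%:R * b).
Proof.
elim: n => [|n IHn]; first by rewrite big_geq // !mulr0 mul0r sin0 mulr0.
rewrite big_nat_recr //= mulrDr IHn -[n.+1%:R]natr1 exprS.
have -> : 2 * n%:R * b = (2 * n%:R + 1) * b - b by ring.
have -> : 2 * (n%:R + 1) * b = (2 * n%:R + 1) * b + b by ring.
by rewrite sinB sinD; ring.
Qed.

Lemma sin_odd_pihalf k : sin ((2 * k%:R + 1) * (pi / 2)) = (-1) ^+ k :> R.
Proof.
have -> : (2 * k%:R + 1) * (pi / 2) = k%:R * pi + pi / 2 :> R by field.
by rewrite sinDpihalf cos_natpi.
Qed.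

Lemma cos_odd_pihalf k : cos ((2 * k%:R + 1) * (pi / 2)) = 0 :> R.
Proof.
have -> : (2 * k%:R + 1) * (pi / 2) = k%:R * pi + pi / 2 :> R by field.
by rewrite cosDpihalf sin_natpi oppr0.
Qed.

Definition alternating_sine n k : R :=
  \sum_(0 <= i < n) (-1) ^+ i.+1 * sin ((2 * k%:R + 1) * odd_angle n i).

(** In the telescoped value, 2nb is (2k+1) pi/2 - b, whose sine is
    (-1)^k cos b; the factor cos b then cancels. *)
Lemma alternating_sine_generic n k :
  cos ((2 * k%:R + 1) * pi / (4 * n%:R + 2)) != 0 :> R ->
  alternating_sine n k = (-1) ^+ n * (-1) ^+ k / 2.
Proof.
set b := _ / _ => b0; have n0 : 0 <= n%:R :> R by [].
have d0 : 4 * n%:R + 2 != 0 :> R by lra.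
have -> : alternating_sine n k =
    \sum_(0 <= i < n) (-1) ^+ i.+1 * sin ((2 * i%:R + 1) * b).
  by apply: eq_bigr => i _; congr (_ * sin _); rewrite /b /odd_angle; field.
apply: (@mulfI _ (2 * cos b)); first by rewrite mulf_neq0.
rewrite sin_alternating_telescope.
have -> : 2 * n%:R * b = (2 * k%:R + 1) * (pi / 2) - b by rewrite /b; field.
by rewrite sinB sin_odd_pihalf cos_odd_pihalf mul0r subr0; field.
Qed.

(** For k = n + (2n+1)l one has 2k+1 = (2n+1)(2l+1), so that all the angles
    are odd multiples of pi/2 and the n terms are equal. *)
Lemma alternating_sine_resonant n l :
  alternating_sine n (n + (2 * n + 1) * l) = - n%:R * (-1) ^+ l.
Proof.
have n0 : 0 <= n%:R :> R by [].
have d0 : 4 * n%:R + 2 != 0 :> R by lra.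
transitivity (\sum_(0 <= i < n) - (-1) ^+ l : R); last first.
  by rewrite sumr_const_nat subn0 mulNrn mulNr mulr_natl.
apply: eq_bigr => i _.
have -> : (2 * (n + (2 * n + 1) * l)%:R + 1) * odd_angle n i =
    (2 * (2 * (i * l) + i + l)%:R + 1) * (pi / 2).
  by rewrite /odd_angle !(natrD, natrM); field.
have -> : (2 * (i * l) + i + l = 2 * (i * l) + (i + l))%N by lia.
rewrite sin_odd_pihalf exprD exprM sqrrN !expr1n mul1r exprD exprS.
by rewrite mulrA -[-1 * _ * _]mulrA -expr2 sqrr_sign mulr1 mulN1r.
Qed.

(** The angle is pi/2 + l pi + r pi / (2n+1), and 0 < r < 2n+1 keeps it away
    from the zeros of the cosine. *)
Lemma cos_off_resonance n l r : (0 < r < 2 * n + 1)%N ->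
  cos ((2 * (n + (2 * n + 1) * l + r)%:R + 1) * pi / (4 * n%:R + 2)) != 0 :> R.
Proof.
move=> /andP[r0 rn]; have n0 : 0 <= n%:R :> R by [].
have d0 : 0 < 2 * n%:R + 1 :> R by lra.
have r0R : 0 < r%:R :> R by rewrite ltr0n.
have rnR : r%:R < 2 * n%:R + 1 :> R 
  by rewrite (_ : _ + 1 = (2 * n + 1)%:R) ?ltr_nat // natrD natrM.
have p0 := pi_gt0 R.
have -> : (2 * (n + (2 * n + 1) * l + r)%:R + 1) * pi / (4 * n%:R + 2) =
   (r%:R * pi / (2 * n%:R + 1) + l%:R * pi) + pi / 2 :> R.
  rewrite !natrD natrM natrD natrM; field.
  by apply/andP; split; lra.
rewrite cosDpihalf sinD sin_natpi cos_natpi mulr0 addr0 oppr_eq0.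
rewrite mulf_neq0 ?signr_eq0 // gt_eqF // sin_gt0_pi //; apply/andP; split.
  by rewrite divr_gt0 // mulr_gt0.
by rewrite ltr_pdivrMr // mulrC ltr_pM2l.
Qed.

Lemma cos_below_resonance n k : (k < n)%N ->
  cos ((2 * k%:R + 1) * pi / (4 * n%:R + 2)) != 0 :> R.
Proof.
move=> /odd_angle_bounds /andP[a0 api]; have p0 := pi_gt0 R.
by rewrite gt_eqF // cos_gt0_pihalf //; rewrite /odd_angle in a0 api; lra.
Qed.

(** The number of terms n + (2n+1)L is chosen so that exactly L resonant
    indices occur: each block of 2n+1 consecutive indices added in the
    induction starts with a resonant one. The generic value is used for every
    term, and the second series corrects the resonant ones. *)
Lemma alternating_sine_sum n L :
  \sum_(0 <= k < n + (2 * n + 1) * L)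
     alternating_sine n k / (2 * k%:R + 1) ^+ 2 =
  (-1) ^+ n / 2 * series (catalan_term R) (n + (2 * n + 1) * L)%N
  - (2 * (2 * n%:R + 1))^-1 * series (catalan_term R) L.
Proof.
have n0 : 0 <= n%:R :> R by [].
have term k : cos ((2 * k%:R + 1) * pi / (4 * n%:R + 2)) != 0 :> R ->
    alternating_sine n k / (2 * k%:R + 1) ^+ 2 = (-1) ^+ n / 2 * catalan_term R k.
  by move=> /alternating_sine_generic ->; rewrite /catalan_term; field; rewrite odd_neq0.
elim: L => [|L IHL].
  have s0 : series (catalan_term R) 0 = 0 by rewrite /series /= big_geq.
  rewrite muln0 addn0 s0 mulr0 subr0 /series /= mulr_sumr.
  rewrite big_nat [RHS]big_nat; apply: eq_bigr => k kn.
  by rewrite term ?cos_below_resonance.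
have -> : (n + (2 * n + 1) * L.+1 = (2 * n).+1 + (n + (2 * n + 1) * L))%N by lia.
rewrite (big_cat_nat _ (n := n + (2 * n + 1) * L)) ?leq_addl //= IHL.
set m := (n + (2 * n + 1) * L)%N; rewrite (series_addn _ m) seriesSr.
have first_term (f : nat -> R) : \sum_(m <= k < (2 * n).+1 + m) f k =
    f m + \sum_(m.+1 <= k < (2 * n).+1 + m) f k by rewrite big_ltn //; lia.
rewrite !first_term {1}/m alternating_sine_resonant.
have -> : \sum_(m.+1 <= k < (2 * n).+1 + m)
    alternating_sine n k / (2 * k%:R + 1) ^+ 2 =
  (-1) ^+ n / 2 * \sum_(m.+1 <= k < (2 * n).+1 + m) catalan_term R k.
  rewrite mulr_sumr big_nat [RHS]big_nat; apply: eq_bigr => k /andP[mk km].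
  rewrite term // -(subnKC (ltnW mk)); apply: cos_off_resonance; lia.
have -> : catalan_term R m =
    (-1) ^+ n * (-1) ^+ L / ((2 * n%:R + 1) * (2 * L%:R + 1)) ^+ 2.
  rewrite /catalan_term; congr (_ / _ ^+ 2); last first.
    by rewrite /m natrD natrM natrD natrM; ring.
  by rewrite /m exprD exprM addn1 exprS exprM sqrrN !expr1n mulr1.
have -> : 2 * m%:R + 1 = (2 * n%:R + 1) * (2 * L%:R + 1) :> R.
  by rewrite /m natrD natrM natrD natrM; ring.
have /orP[/eqP sgn|/eqP sgn] : ((-1) ^+ n == 1 :> R) || ((-1) ^+ n == -1 :> R).
  by rewrite -sqrf_eq1 sqrr_sign.
all: rewrite sgn /catalan_term; field.
all: by rewrite !odd_neq0.
Qed.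

End Angles.

(** * The acceleration formula *)

Section Acceleration.
Local Open Scope classical_set_scope.
Local Open Scope ring_scope.
Variable R : realType.
Implicit Types n k M : nat.

Lemma cvg_inv_odd_sqr_series (a : nat -> R) :
  (forall k, `|a k| <= 1) ->
  cvgn (series (fun k => a k / (2 * k%:R + 1) ^+ 2)).
Proof.
move=> a1; apply: normed_cvg.
apply: (@series_le_cvg R _ (fun k => (2 * k%:R + 1) ^- 2)) => [k|k|k|].
- exact: normr_ge0.
- by rewrite invr_ge0 sqr_ge0.
- rewrite /= normrM normfV [X in _ / X]ger0_norm ?sqr_ge0 //.
  by rewrite ler_piMl ?invr_ge0 ?sqr_ge0.
apply: nondecreasing_is_cvgn.
  by apply: nondecreasing_series => k _ _; rewrite invr_ge0 sqr_ge0.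
by exists 2 => _ [M _ <-]; exact: inv_odd_sqr_sum_le2.
Qed.

Lemma cvg_bigsum (f : nat -> nat -> R) (l : nat -> R) n :
  (forall i, (i < n)%N -> f i M @[M --> \oo] --> l i) ->
  (\sum_(0 <= i < n) f i M) @[M --> \oo] --> \sum_(0 <= i < n) l i.
Proof.
elim: n => [|n IHn] fl.
  rewrite big_geq //; under eq_fun do rewrite big_geq //; exact: cvg_cst.
rewrite big_nat_recr //=; under eq_fun do rewrite big_nat_recr //=.
by apply: cvgD; [apply: IHn => i lt_in; apply: fl; exact: ltnW|exact: fl].
Qed.

(** Reindexing by j = n - i turns the cosines into the sines of the
    complementary angles, and odd powers keep the signs. *)
Lemma accel_FE n k : accel_F R n (2 * k + 1) =
  \sum_(0 <= i < n) (-1) ^+ i.+1 * (2 * sin (odd_angle R n i)) ^+ (2 * k + 1).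
Proof.
rewrite /accel_F big_add1 /= big_nat_rev /= big_nat [RHS]big_nat.
apply: eq_bigr => i /andP[_ lt_in].
have -> : (0 + n - i.+1).+1 = (n - i)%N by lia.
have -> : (n - (n - i) + 1 = i.+1)%N by lia.
rewrite -mulrA exprMn.
have -> : (-1) ^+ i.+1 ^+ (2 * k + 1) = (-1) ^+ i.+1 :> R.
  by rewrite exprD exprM sqrr_sign expr1n mul1r.
congr (_ * (_ * _) ^+ _).
have n0 : 0 <= n%:R :> R by [].
rewrite -cosBpihalf -cosN; congr cos.
rewrite natrB; last exact: ltnW.
by rewrite /odd_angle; field; apply/andP; split; lra.
Qed.

Lemma accel_seriesE n M : series (accel_term R n) M =
  \sum_(0 <= i < n) (-1) ^+ i.+1 * arcsine_sum R M (odd_angle R n i).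
Proof.
rewrite /series /= /arcsine_sum.
under [RHS]eq_bigr do rewrite mulr_sumr.
rewrite exchange_big /=; apply: eq_bigr => k _.
rewrite /accel_term accel_FE mulr_suml; apply: eq_bigr => i _.
by rewrite mulrA.
Qed.

Lemma accel_angleE n i : (2 * i.+1%:R - 1) * pi / (8 * n%:R + 4) =
  2^-1 * odd_angle R n i.
Proof.
have n0 : 0 <= n%:R :> R by [].
by rewrite /odd_angle -[i.+1%:R]natr1; field; apply/andP; split; lra.
Qed.

Lemma half_odd_angle_bounds n i : (i < n)%N ->
  0 < 2^-1 * odd_angle R n i < pi / 2.
Proof. by move=> /(odd_angle_bounds R); have := pi_gt0 R; lra. Qed.

Lemma tan_half_odd_angle_gt0 n i : (i < n)%N -> 0 < tan (2^-1 * odd_angle R n i).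
Proof.
move=> /half_odd_angle_bounds /andP[a0 api]; have p0 := pi_gt0 R.
by rewrite /tan divr_gt0 ?sin_gt0_pihalf ?cos_gt0_pihalf ?a0 //; lra.
Qed.

Lemma accel_u_unit n : algebraic_unit (accel_u R n).
Proof.
rewrite /accel_u big_add1 /= big_nat; apply: big_ind => [||i /andP[_ lt_in]].
- exact: algebraic_unit1.
- exact: algebraic_unitM.
rewrite accel_angleE; apply: algebraic_unit_exprz.
have /andP[a0 api] := half_odd_angle_bounds _ _ lt_in; have p0 := pi_gt0 R.
apply: (algebraic_unit_tan R n).
- by rewrite gt_eqF // cos_gt0_pihalf //; lra.
- by rewrite gt_eqF // sin_gt0_pihalf //; lra.
- have n0 : 0 <= n%:R :> R by [].
  have -> : (2 * n%:R + 1) * (2^-1 * odd_angle R n i) *+ 2 =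
      (2 * i%:R + 1) * (pi / 2).
    by rewrite /odd_angle; field; lra.
  exact: cos_odd_pihalf.
Qed.

Lemma ln_exprz (x : R) (z : int) : 0 < x -> ln (x ^ z) = z%:~R * ln x.
Proof.
move=> x0; case: z => k; first by rewrite -exprnP lnXn // mulr_natl.
rewrite NegzE -invr_expz lnV ?posrE ?exprz_gt0 // -exprnP lnXn //.
by rewrite mulrNz mulNr mulr_natl.
Qed.

Lemma ln_accel_u n : ln (accel_u R n) = \sum_(0 <= i < n)
  (-1) ^+ i.+1 * ((2 * i%:R + 1) * ln_tan_half R (odd_angle R n i)).
Proof.
rewrite /accel_u big_add1 /=.
have : forall m, (m <= n)%N ->
   0 < \prod_(0 <= i < m) tan ((2 * i.+1%:R - 1) * pi / (8 * n%:R + 4))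
      ^ ((2 * i.+1%:Z - 1) * (-1) ^+ i.+1) :> R /\
   ln (\prod_(0 <= i < m) tan ((2 * i.+1%:R - 1) * pi / (8 * n%:R + 4))
      ^ ((2 * i.+1%:Z - 1) * (-1) ^+ i.+1)) =
   \sum_(0 <= i < m)
     (-1) ^+ i.+1 * ((2 * i%:R + 1) * ln_tan_half R (odd_angle R n i)) :> R.
  elim=> [_|m IHm lt_mn]; first by rewrite !big_geq // ln1.
  have [p0 lnp] := IHm (ltnW lt_mn).
  have t0 := tan_half_odd_angle_gt0 _ _ lt_mn.
  rewrite !big_nat_recr //= accel_angleE mulr_gt0 ?exprz_gt0 //; split=> //.
  rewrite lnM ?posrE ?exprz_gt0 // lnp ln_exprz //; congr (_ + _).
  have -> : (2 * m.+1%:Z - 1) * (-1) ^+ m.+1 = (-1) ^+ m.+1 * (2 * m%:Z + 1).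
    by rewrite mulrC; congr (_ * _); lia.
  by rewrite intrM rmorphXn /= rmorphN1 intrD intrM -!pmulrn -mulrA.
by move/(_ n (leqnn n)) => [].
Qed.

Lemma cvg_accel_series n : odd n ->
  series (accel_term R n) @ \oo -->
    pi / (2 * n%:R + 1) * ln (accel_u R n)
    - 2 * (1 + (2 * n%:R + 1)^-1) * catalan R.
Proof.
move=> n_odd; have n0 : 0 <= n%:R :> R by [].
have sgn : (-1) ^+ n = -1 :> R by rewrite -signr_odd n_odd.
have cvgG : series (catalan_term R) @ \oo --> catalan R.
  by apply: cvg_inv_odd_sqr_series => k; rewrite normrX normrN1 expr1n.
have cvgT t : cvgn (fun M => sine_sum R M t).
  by apply: cvg_inv_odd_sqr_series => k; exact: sin_max.
pose T t := limn (fun M => sine_sum R M t).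
(* Each sine sum converges, so the limit of their alternating sum may be read
   off along the lengths n + (2n+1)L, where it is known in terms of G. *)
have sumT : \sum_(0 <= i < n) (-1) ^+ i.+1 * T (odd_angle R n i) =
    - (1 + (2 * n%:R + 1)^-1) / 2 * catalan R.
  pose sub L := (n + (2 * n + 1) * L)%N.
  have cvg_sub : sub L @[L --> \oo] --> \oo.
    apply: (cvg_comp (fun L => (2 * n + 1) * L)%N (addn n)); last exact: cvg_addnl.
    by apply: cvg_mulnl; lia.
  have l1 : (\sum_(0 <= i < n) (-1) ^+ i.+1 * sine_sum R (sub L) (odd_angle R n i))
     @[L --> \oo] --> \sum_(0 <= i < n) (-1) ^+ i.+1 * T (odd_angle R n i).
    apply: cvg_bigsum => i _; apply: cvgMl_tmp.
    apply: (cvg_comp sub (fun M => sine_sum R M (odd_angle R n i)) cvg_sub).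
    exact: cvgT.
  have l2 : ((-1) ^+ n / 2 * series (catalan_term R) (sub L)
      - (2 * (2 * n%:R + 1))^-1 * series (catalan_term R) L) @[L --> \oo] -->
     (-1) ^+ n / 2 * catalan R - (2 * (2 * n%:R + 1))^-1 * catalan R.
    apply: cvgB; apply: cvgMl_tmp; last exact: cvgG.
    exact: cvg_comp cvg_sub cvgG.
  have -> : - (1 + (2 * n%:R + 1)^-1) / 2 * catalan R =
      (-1) ^+ n / 2 * catalan R - (2 * (2 * n%:R + 1))^-1 * catalan R.
    by rewrite sgn; field; lra.
  apply: (cvg_unique _ l1) => //.
  rewrite (_ : (fun L => _) = fun L => (-1) ^+ n / 2 * series (catalan_term R) (sub L)
     - (2 * (2 * n%:R + 1))^-1 * series (catalan_term R) L) //.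
  apply/funext => L; rewrite -alternating_sine_sum /sine_sum.
  under eq_bigr do rewrite mulr_sumr.
  rewrite exchange_big /=; apply: eq_bigr => k _.
  by rewrite /alternating_sine mulr_suml; apply: eq_bigr => i _; rewrite mulrA.
have -> : pi / (2 * n%:R + 1) * ln (accel_u R n)
    - 2 * (1 + (2 * n%:R + 1)^-1) * catalan R =
  \sum_(0 <= i < n) (-1) ^+ i.+1 * (0 + 4 * T (odd_angle R n i)
     + 2 * odd_angle R n i * ln_tan_half R (odd_angle R n i)).
  under eq_bigr do rewrite add0r mulrDr mulrCA.
  rewrite big_split /= -mulr_sumr sumT ln_accel_u mulr_sumr addrC; congr (_ + _).
  apply: eq_bigr => i _; rewrite mulrCA; congr (_ * _).
  by rewrite mulrA; congr (_ * _); rewrite /odd_angle; field; apply/andP; split; lra.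
  by field; lra.
rewrite (_ : series (accel_term R n) = fun M => \sum_(0 <= i < n) (-1) ^+ i.+1 *
   (expansion_error R M (odd_angle R n i) + 4 * sine_sum R M (odd_angle R n i)
     + 2 * odd_angle R n i * ln_tan_half R (odd_angle R n i))); last first.
  apply/funext => M; rewrite accel_seriesE; apply: eq_bigr => i _; congr (_ * _).
  by rewrite /expansion_error; ring.
apply: cvg_bigsum => i lt_in; apply: cvgMl_tmp; apply: cvgD; last exact: cvg_cst.
apply: cvgD; first by apply: cvg_expansion_error; exact: odd_angle_bounds.
by apply: cvgMl_tmp; exact: cvgT.
Qed.

End Acceleration.

Theorem theorem7 (R : realType) (n : nat) (n_odd : odd n) :
  [/\ algebraic_unit (accel_u R n),
      cvgn (series (accel_term R n)) &
      catalan R =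
        pi / (4 * n%:R + 4) * ln (accel_u R n)
        - (2 * n%:R + 1) / (4 * n%:R + 4) * limn (series (accel_term R n))].
Proof.
have cvgS := cvg_accel_series R n n_odd; have n0 : 0 <= n%:R :> R by [].
split; [exact: accel_u_unit|exact: cvgP cvgS|].
by rewrite (cvg_lim _ cvgS) //; field; apply/andP; split; lra.
Qed.
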